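(* Let $K$ be a field, let $1\le n<m$, and let $f(X,Y)=\sum_{i=0}^{n}a_{i}Y^{i}$, $g(X,Y)=\sum_{i=0}^{m}b_{i}Y^{i}\in K[X,Y]$, with $a_{0},\dots,a_{n},b_{0},\dots,b_{m}\in K[X]$ and $a_{0}a_{n}b_{0}b_{m}\neq 0$. Assume that $f$ has no nonconstant factors in $K[X]$, that $\gcd(b_{n+1},\dots,b_{m})\in K$, and that $Res_{Y}(f,g)$ is irreducible over $K$. If $$\deg a_{0}>\max\{\deg a_{1},\ldots,\deg a_{n}\},$$ $$\deg b_{m}\geq\max\{\deg b_{0},\ldots,\deg b_{m-1}\},$$ $$\deg a_i\leq\deg b_i\quad\text{for } i=0,\dots,n,$$ then $\alpha f+\beta g$ is irreducible in $K[X,Y]$ for any $\alpha,\beta\in K$, not both zero.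
   Context: $Res_Y(f,g)\in K[X]$ is the resultant of $f$ and $g$ regarded as polynomials in $Y$ with coefficients in $K[X]$; $\deg$ is the degree in $X$, with $\deg 0=-\infty$. *)

(* Defs.v *)
From HB Require Import structures.
From mathcomp Require Import all_boot all_order all_algebra.

Set Implicit Arguments.
Unset Strict Implicit.
Unset Printing Implicit Defensive.

Import GRing.Theory.
Local Open Scope ring_scope.

(* K[X,Y] is represented as {poly {poly K}}: the outer indeterminate is Y and
   the inner one is X.  MathComp's [irreducible_poly] compares sizes, i.e.
   degrees in the outer indeterminate, so over {poly K} it does not express
   irreducibility in K[X,Y]: it disregards factors that lie in K[X].  The
   following is the usual notion in an integral domain; the units of
   {poly {poly K}} are the nonzero elements of K. *)
Definition irreducible_elt (R : idomainType) (p : R) : Prop :=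
  [/\ p != 0, p \isn't a GRing.unit
    & forall q r : R, p = q * r ->
        q \is a GRing.unit \/ r \is a GRing.unit].

(* Main.v *)
Require Import Defs.
From HB Require Import structures.
From mathcomp Require Import all_boot all_order all_algebra.
From mathcomp Require Import polyXY perm zify.

Set Implicit Arguments.
Unset Strict Implicit.
Unset Printing Implicit Defensive.

Import GRing.Theory.
Local Open Scope ring_scope.

(** Each factor of alpha f + beta g has a resultant with f or with g, and these
    resultants multiply to a constant times Res(f, g), which is irreducible.
    So one of them is a constant.  The degree conditions on f and g bound the
    X-degree of such a resultant from below, and the bound is 0 only for units.

    Let top(u) in K[Y] be the leading coefficient of u regarded as a polynomial
    in X ([lead_coefX]).  It is multiplicative.  The condition on the a_i says
    that top(f) is a nonzero constant, and the one on the b_i says that top(g)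
    has the same Y-degree as g; as deg a_i <= deg b_i, the same holds for
    h = alpha f + beta g when beta <> 0.  Since top(u v) = top(u) top(v) and
    deg_Y top(u) <= deg_Y u, both properties pass to factors
    ([size_lead_coefX_factor1] and [size_lead_coefX_factor]).

    If top(p) is constant and deg_Y top(q) = deg_Y q, then
      deg_X Res(p, q) >= deg_Y q * deg_X p + deg_Y p * deg_X q
    ([size_resultant_lead_coefX]): the coefficient of this degree is the
    determinant obtained from the Sylvester matrix by keeping in each row the
    coefficient of the largest possible X-degree, that is, the Sylvester matrix
    of top(p) and top(q) with formal degrees deg_Y p and deg_Y q, and this
    matrix is triangular with nonzero diagonal.

    Suppose beta <> 0 and h = u v.  Then
      Res(f, u) Res(f, v) = Res(f, h) = beta^n Res(f, g),
    so one factor, say Res(f, u), is constant.  As deg_Y f > 0 and deg_X f > 0,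
    the degree bound forces deg_X u = deg_Y u = 0.  If beta = 0, the same
    argument with the resultants Res(u, g) gives deg_X u = 0, and then
    u = top(u) is constant.

    The product rule, and Res(p, r p + c q) = c^(deg p) Res(p, q) when r p + c q
    has the degree of q ([resultantM], [resultant_lin]), come from the formula
      Res(p, q) = ((-1)^(deg p) lc(p))^(deg q) det(multiplication by q mod p)
    over a field ([resultantE]), applied in the fraction field of K[X].  They
    hold for the first argument as well, up to sign ([resultantC]). *)

(** * The resultant as a norm *)

(** Row vectors of length deg p stand for the polynomials modulo p, and this is
    the matrix of multiplication by q on them. *)
Definition remainder_mx (F : fieldType) (p q : {poly F}) (d := (size p).-1) :
    'M[F]_d :=
  \matrix_(i < d) poly_rV (('X^i * q) %% p).

Lemma mul_remainder_mx (F : fieldType) (p q : {poly F}) (u : 'rV_(size p).-1) :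
  u *m remainder_mx p q = poly_rV ((rVpoly u * q) %% p).
Proof.
have modX : (rVpoly u * q) %% p = \sum_i u 0 i *: (('X^i * q) %% p).
  rewrite [in LHS](row_sum_delta u) linear_sum /= mulr_suml.
  rewrite (big_morph (fun r => r %% p) (modpD p) (mod0p p)).
  by apply: eq_bigr => i _; rewrite linearZ /= rVpoly_delta -scalerAl modpZl.
rewrite modX linear_sum mulmx_sum_row; apply: eq_bigr => i _.
by rewrite rowK linearZ.
Qed.

Lemma size_modp_pred (F : fieldType) (p r : {poly F}) :
  p != 0 -> (size (r %% p)%R <= (size p).-1)%N.
Proof. by move=> p0; rewrite -ltnS -polySpred // ltn_modp. Qed.

Lemma remainder_mxM (F : fieldType) (p q1 q2 : {poly F}) : p != 0 ->
  remainder_mx p (q1 * q2) = remainder_mx p q1 *m remainder_mx p q2.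
Proof.
move=> p0; apply/row_matrixP => i; rewrite row_mul rowK mul_remainder_mx rowK.
rewrite poly_rV_K ?size_modp_pred // mulrA.
by rewrite ![_ * q2]mulrC modp_mul.
Qed.

Lemma remainder_mx_lin (F : fieldType) (p q r : {poly F}) (c : F) :
  remainder_mx p (r * p + c *: q) = c *: remainder_mx p q.
Proof.
apply/row_matrixP => i; rewrite rowK linearZ /= rowK -linearZ /= -modpZl.
by rewrite mulrDr mulrA modpD modp_mull add0r -scalerAr.
Qed.

(** The rows are the coefficients of p, Y p, .., Y^(m-1) p, 1, Y, .., Y^(n-1).
    For n = deg p these polynomials form a basis adapted to division by p:
    a quotient of degree below m, followed by a remainder. *)
Definition shift_mx (R : nzRingType) (p : {poly R}) (m n : nat) :
    'M[R]_(m + n) :=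
  \matrix_(i, j) (if (i < m)%N then p`_(j - i) *+ (i <= j)
                  else (j == (i - m)%N :> nat)%:R).

(** Expansion along the last column: its only nonzero entry is the leading
    coefficient of p, in the last of the m shifted rows.  It lies n columns to
    the right of the diagonal, whence the sign. *)
Lemma det_shift_mx (R : comNzRingType) (p : {poly R}) (m : nat) :
  \det (shift_mx p m (size p).-1) = ((-1) ^+ (size p).-1 * lead_coef p) ^+ m.
Proof.
rewrite lead_coefE; have := leqSpred (size p); move: (size p).-1 => n le_p_n.
elim: m => [|m IHm]; first rewrite expr0.
  have -> : shift_mx p 0 n = 1%:M; last by rewrite det1.
  by apply/matrixP=> i j; rewrite !mxE /= subn0 eq_sym.
have lt_m : (m < (m + n).+1)%N by rewrite ltnS leq_addr.
rewrite (expand_det_col _ ord_max) (bigD1 (Ordinal lt_m)) //=.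
rewrite big1 => [|i ne_im].
  rewrite addr0 mxE /= ltnSn addKn leq_addr mulr1n /cofactor /= exprS -IHm.
  rewrite mulrCA -mulrA; congr (_ * _); last congr (_ * _).
    by rewrite addnA exprD addnn -mul2n exprM sqrrN expr1n expr1n mul1r.
  congr (\det _); apply/matrixP=> i j; rewrite !mxE /= /bump /=.
  have -> : ((m + n)%N <= j)%N = false by rewrite leqNgt ltn_ord.
  rewrite add0n; case: (leqP m i) => [le_mi|lt_im] /=.
    by rewrite add1n ltnS ltnNge le_mi /= subSS.
  by rewrite add0n ltnS (ltnW lt_im).
rewrite mxE; case: ltnP => [lt_im | ge_im].
  rewrite nth_default ?mul0rn ?mul0r // (leq_trans le_p_n) //=.
  have ltim : (i < m)%N.
    by rewrite ltn_neqAle -ltnS lt_im andbT -[m]/(val (Ordinal lt_m)) val_eqE.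
  by rewrite ltn_subRL ltn_add2r.
have lt_in : (i - m.+1 < n)%N by rewrite ltn_subLR // (ltn_ord i).
by rewrite /= gtn_eqF ?mul0r // (leq_trans lt_in) ?leq_addl.
Qed.

Lemma mul_shift_mx (R : comNzRingType) (p : {poly R}) (m n : nat)
    (u : 'rV[R]_m) (v : 'rV[R]_n) :
  row_mx u v *m shift_mx p m n = poly_rV (rVpoly u * p + rVpoly v).
Proof.
have -> : shift_mx p m n =
    col_mx (lin1_mx (poly_rV \o p \o* rVpoly)) (lin1_mx (poly_rV \o rVpoly)).
  apply/matrixP => i j; rewrite mxE; case: (split_ordP i) => k ->.
    by rewrite col_mxEu !mxE /= rVpoly_delta coefXnM ltnNge if_neg mulrb.
  by rewrite col_mxEd !mxE /= rVpoly_delta coefXn addKn.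
by rewrite mul_row_col !mul_rV_lin1 /= linearD.
Qed.

(** Division with remainder of the rows Y^i q by p writes the Sylvester matrix
    as a block triangular matrix times the basis [shift_mx]. *)
Lemma resultantE (F : fieldType) (p q : {poly F}) : p != 0 ->
  resultant p q =
    ((-1) ^+ (size p).-1 * lead_coef p) ^+ (size q).-1
      * \det (remainder_mx p q).
Proof.
move=> p0; rewrite -det_shift_mx mulrC.
pose Q : 'M_((size p).-1, (size q).-1) :=
  \matrix_(i < _) poly_rV (('X^i * q) %/ p).
suff Syl : Sylvester_mx p q =
    block_mx 1%:M 0 Q (remainder_mx p q) *m shift_mx p (size q).-1 (size p).-1.
  by rewrite /resultant Syl det_mulmx det_lblock det1 mul1r.
apply/row_matrixP => i; rewrite row_mul /Sylvester_mx /block_mx.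
case: (split_ordP i) => k ->; rewrite ?(rowKu, rowKd) row_row_mx mul_shift_mx.
  rewrite row1 row0 linear0 addr0 rVpoly_delta.
  by rewrite rowE mul_rV_lin1 /= rVpoly_delta.
rewrite !rowK !poly_rV_K ?size_modp_pred // -?divp_eq.
  by rewrite rowE mul_rV_lin1 /= rVpoly_delta.
rewrite size_divp //; have [->|q0] := eqVneq q 0.
  by rewrite mulr0 size_poly0 sub0n.
rewrite mulrC size_mulXn // leq_subLR.
by rewrite (polySpred q0) addnS -addSn leq_add2r ltn_ord.
Qed.

Lemma resultantM_field (F : fieldType) (p q1 q2 : {poly F}) :
  p != 0 -> q1 != 0 -> q2 != 0 ->
  resultant p (q1 * q2) = resultant p q1 * resultant p q2.
Proof.
move=> p0 q10 q20; rewrite !resultantE // remainder_mxM // det_mulmx mulrACA.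
rewrite -exprD size_mul //; congr (_ ^+ _ * _).
by rewrite (polySpred q10) (polySpred q20) addnS.
Qed.

Lemma resultant_lin_field (F : fieldType) (p q r : {poly F}) (c : F) :
  p != 0 -> size (r * p + c *: q) = size q ->
  resultant p (r * p + c *: q) = c ^+ (size p).-1 * resultant p q.
Proof.
by move=> p0 sz; rewrite !resultantE // sz remainder_mx_lin detZ mulrCA.
Qed.

(** * Rules for resultants over K[X] *)

Lemma tofrac_inj (R : idomainType) : injective (@tofrac R).
Proof. by move=> x y /eqP; rewrite tofrac_eq => /eqP. Qed.

Lemma size_map_tofrac (K : idomainType) (u : {poly {poly K}}) :
  size (map_poly (@tofrac {poly K}) u) = size u.
Proof. exact: (size_map_inj_poly (@tofrac_inj _) (tofrac0 _)). Qed.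

Lemma map_tofrac_eq0 (K : idomainType) (u : {poly {poly K}}) :
  (map_poly (@tofrac {poly K}) u == 0) = (u == 0).
Proof. by rewrite -!size_poly_eq0 size_map_tofrac. Qed.

Lemma tofrac_resultant (K : idomainType) (p q : {poly {poly K}}) :
  p != 0 -> q != 0 ->
  tofrac (resultant p q) =
    resultant (map_poly (@tofrac _) p) (map_poly (@tofrac _) q).
Proof. by move=> p0 q0; rewrite map_resultant // tofrac_eq0 lead_coef_eq0. Qed.

Lemma resultantM (K : idomainType) (p q1 q2 : {poly {poly K}}) :
  p != 0 -> q1 != 0 -> q2 != 0 ->
  resultant p (q1 * q2) = resultant p q1 * resultant p q2.
Proof.
move=> p0 q10 q20; apply: tofrac_inj; rewrite rmorphM /=.
rewrite !tofrac_resultant ?mulf_neq0 // rmorphM.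
by rewrite resultantM_field ?map_tofrac_eq0.
Qed.

Lemma resultant_lin (K : idomainType) (p q r : {poly {poly K}})
    (c : {poly K}) :
  p != 0 -> q != 0 -> size (r * p + c *: q) = size q ->
  resultant p (r * p + c *: q) = c ^+ (size p).-1 * resultant p q.
Proof.
move=> p0 q0 sz; apply: tofrac_inj; rewrite rmorphM rmorphXn /=.
rewrite !tofrac_resultant //; last by rewrite -size_poly_eq0 sz size_poly_eq0.
pose F := map_poly (@tofrac {poly K}).
have mapE : F (r * p + c *: q) = F r * F p + tofrac c *: F q.
  by rewrite /F rmorphD rmorphM /= map_polyZ.
rewrite -!/(F _) mapE resultant_lin_field ?map_tofrac_eq0 ?size_map_tofrac //.
by rewrite -mapE !size_map_tofrac.
Qed.

(** The two Sylvester matrices differ by a rotation of the rows, of sign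
    (-1)^s; neither degree nor irreducibility depends on this sign. *)
Lemma resultantC (R : comNzRingType) (p q : {poly R}) :
  exists s : bool, resultant q p = (-1) ^+ s * resultant p q.
Proof.
rewrite /resultant; set m := (size q).-1; set n := (size p).-1.
have rot_lt (i : 'I_(m + n)) : ((if i < n then m + i else i - n) < m + n)%N.
  by have := ltn_ord i; case: (ltnP i n); lia.
have rot_inj : injective (fun i => Ordinal (rot_lt i)).
  move=> i j [] eq_ij; apply: ord_inj; have := ltn_ord i; have := ltn_ord j.
  by move: eq_ij; case: (ltnP i n); case: (ltnP j n); lia.
exists (perm rot_inj); rewrite -det_perm -det_mulmx -row_permE.
pose band r i j : R := r`_(j - i) *+ (i <= j)%N.
pose E i j := if (i < n)%N then band q i j else band p (i - n)%N j.
have det_addC d (eq_d : (n + m)%N = d) :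
    \det (Sylvester_mx q p) = \det (\matrix_(i < d, j < d) E i j).
  case: d / eq_d; congr (\det _); apply/matrixP => i j.
  rewrite Sylvester_mxE mxE /E; case: (split_ordP i) => k -> //=.
  by rewrite addKn.
rewrite (det_addC _ (addnC n m)); congr (\det _); apply/matrixP => i j.
rewrite [RHS]mxE permE Sylvester_mxE mxE /E.
case: splitP => k /=; rewrite -/m; case: (ltnP i n) => [lt_in|le_ni] eq_ik.
- by exfalso; have := ltn_ord k; rewrite -/m; lia.
- by rewrite eq_ik.
- by rewrite (addnI eq_ik).
- by exfalso; have := ltn_ord i; lia.
Qed.

(** * Top coefficients of determinants *)

Lemma coefM_size_bound (R : nzRingType) (p q : {poly R}) (d e : nat) :
  (size p <= d.+1)%N -> (size q <= e.+1)%N -> (p * q)`_(d + e) = p`_d * q`_e.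
Proof.
move=> le_pd le_qe; have lt_d : (d < (d + e).+1)%N by rewrite ltnS leq_addr.
rewrite coefM (bigD1 (Ordinal lt_d)) //= addKn big1 ?addr0 // => i ne_id.
case: (ltngtP i d) => [lt_id | lt_di | eq_id].
- rewrite [q`__]nth_default ?mulr0 // (leq_trans le_qe) //.
  by rewrite ltn_subRL ltn_add2r.
- by rewrite nth_default ?mul0r // (leq_trans le_pd).
- by case/eqP: ne_id; apply: val_inj.
Qed.

Lemma coef_prod_size_bound (R : comNzRingType) (I : Type) (r : seq I)
    (F : I -> {poly R}) (d : I -> nat) :
  (forall i, (size (F i) <= (d i).+1)%N) ->
  (size (\prod_(i <- r) F i)%R <= (\sum_(i <- r) d i).+1)%N /\
  (\prod_(i <- r) F i)`_(\sum_(i <- r) d i) = \prod_(i <- r) (F i)`_(d i).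
Proof.
move=> le_Fd; elim: r => [|i r [IHs IHc]].
  by rewrite !big_nil coef1 size_poly1.
rewrite !big_cons coefM_size_bound // IHc; split=> //.
apply: leq_trans (size_polyMleq _ _) _.
by have := leq_add (le_Fd i) IHs; rewrite addSn addnS; case: (_ + _)%N.
Qed.

(** If d i bounds the degrees in row i, every term of the Leibniz expansion has
    degree at most the sum of the d i, with the product of the row-wise top
    coefficients in that degree. *)
Lemma coef_det_size_bound (R : comNzRingType) (n : nat) (A : 'M[{poly R}]_n)
    (d : 'I_n -> nat) : (forall i j, (size (A i j) <= (d i).+1)%N) ->
  (\det A)`_(\sum_i d i) = \det (\matrix_(i, j) (A i j)`_(d i)).
Proof.
move=> le_Ad; rewrite /determinant coef_sum; apply: eq_bigr => s _.
rewrite -(rmorph_sign (@polyC R)) coefCM; congr (_ * _).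
have [_ ->] := coef_prod_size_bound (index_enum 'I_n) (fun i => le_Ad i (s i)).
by apply: eq_bigr => i _; rewrite mxE.
Qed.

(** * Leading coefficients in X *)

(** Here Y is the outer and X the inner variable, while the names [swapXY] and
    [sizeY] have it the other way round: [sizeY u] is 1 + deg_X u, and this is
    the leading coefficient of u in X, a polynomial in Y. *)
Definition lead_coefX (R : nzRingType) (u : {poly {poly R}}) : {poly R} :=
  lead_coef (swapXY u).

Lemma coef_lead_coefX (R : nzRingType) (u : {poly {poly R}}) (i : nat) :
  (lead_coefX u)`_i = u`_i`_(sizeY u).-1.
Proof. by rewrite /lead_coefX lead_coefE coef_swapXY sizeYE. Qed.

Lemma size_lead_coefX_le (R : nzRingType) (u : {poly {poly R}}) :
  (size (lead_coefX u) <= size u)%N.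
Proof. by have := max_size_lead_coefXY (swapXY u); rewrite sizeYE swapXYK. Qed.

Lemma lead_coefXM (R : idomainType) (u v : {poly {poly R}}) :
  lead_coefX (u * v) = lead_coefX u * lead_coefX v.
Proof. by rewrite /lead_coefX rmorphM lead_coefM. Qed.

Lemma lead_coefX_eq0 (R : nzRingType) (u : {poly {poly R}}) :
  (lead_coefX u == 0) = (u == 0).
Proof. by rewrite /lead_coefX lead_coef_eq0 swapXY_eq0. Qed.

Lemma size_lead_coefX_factor1 (R : idomainType) (u v : {poly {poly R}}) :
  size (lead_coefX (u * v)) = 1%N -> size (lead_coefX u) = 1%N.
Proof.
move=> sz1; have: lead_coefX (u * v) != 0 by rewrite -size_poly_eq0 sz1.
rewrite lead_coefXM mulf_eq0 negb_or => /andP[u0 v0].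
move: sz1; rewrite lead_coefXM size_mul //.
rewrite (polySpred u0) (polySpred v0) addSn addnS /= => -[] /eqP.
by rewrite addn_eq0 => /andP[/eqP-> _].
Qed.

(** The Y-degrees of u and of its leading coefficient in X are both additive in
    products, so the inequality between them cannot be strict for a factor. *)
Lemma size_lead_coefX_factor (R : idomainType) (u v : {poly {poly R}}) :
  u * v != 0 -> size (lead_coefX (u * v)) = size (u * v)%R ->
  size (lead_coefX u) = size u.
Proof.
move=> uv0; have := uv0; rewrite mulf_eq0 negb_or => /andP[u0 v0].
rewrite lead_coefXM !size_mul ?lead_coefX_eq0 // => eq_sz.
have le_u := size_lead_coefX_le u; have le_v := size_lead_coefX_le v.
have gt_u : (0 < size (lead_coefX u))%N.
  by rewrite lt0n size_poly_eq0 lead_coefX_eq0.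
have gt_v : (0 < size (lead_coefX v))%N.
  by rewrite lt0n size_poly_eq0 lead_coefX_eq0.
move: eq_sz le_u le_v gt_u gt_v.
by move: (size (lead_coefX u)) (size (lead_coefX v)) (size u) (size v); lia.
Qed.

Lemma size_lead_coefX_const_dominant (R : nzRingType) (u : {poly {poly R}}) :
  u`_0 != 0 -> (forall i, (0 < i)%N -> (size (u`_i)%R < size (u`_0)%R)%N) ->
  size (lead_coefX u) = 1%N.
Proof.
move=> u0 lt_u; have Y_u : sizeY u = size (u`_0)%R.
  apply/anti_leq; rewrite max_size_coefXY andbT.
  apply/bigmax_leqP => -[[|i] ltiu] _ //=.
  exact/ltnW/lt_u.
apply/anti_leq/andP; split.
  apply/leq_sizeP => i lt0i; rewrite coef_lead_coefX Y_u nth_default //.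
  by rewrite -ltnS -polySpred // lt_u.
rewrite lt0n size_poly_eq0 lead_coefX_eq0.
by apply: contraNneq u0 => ->; rewrite coef0.
Qed.

Lemma size_lead_coefX_lead_dominant (R : nzRingType) (u : {poly {poly R}}) :
  u != 0 -> (forall i, (size (u`_i)%R <= size (lead_coef u))%N) ->
  size (lead_coefX u) = size u.
Proof.
move=> u0 le_u; have Y_u : sizeY u = size (lead_coef u).
  apply/anti_leq; rewrite max_size_lead_coefXY andbT.
  by apply/bigmax_leqP => i _; apply: le_u.
apply/anti_leq; rewrite size_lead_coefX_le /= (polySpred u0) ltnNge.
apply/negP => /(nth_default 0).
rewrite coef_lead_coefX Y_u -!lead_coefE => /eqP.
by rewrite !lead_coef_eq0 (negPf u0).
Qed.

(** * Degree of the resultant *)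

(** Seen from infinity in X, the roots of p in Y are large and those of q are
    bounded, so no cancellation occurs in the resultant.  On the Sylvester
    matrix: keeping the top coefficient in X of every entry leaves in a row of
    p only a constant on the diagonal, and in a row of q nothing to the right
    of the leading coefficient, which lies on the diagonal. *)
Lemma size_resultant_lead_coefX (K : fieldType) (p q : {poly {poly K}}) :
  size (lead_coefX p) = 1%N -> q != 0 -> size (lead_coefX q) = size q ->
  ((size q).-1 * (sizeY p).-1 + (size p).-1 * (sizeY q).-1
     < size (resultant p q))%N.
Proof.
move=> top_p q0 top_q; set N := (_ + _)%N.
rewrite ltnNge; apply/negP => /leq_sizeP/(_ N (leqnn N)) /eqP; apply/negP.
pose d (i : 'I_((size q).-1 + (size p).-1)) :=
  if split i is inl _ then (sizeY p).-1 else (sizeY q).-1.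
have -> : N = \sum_i d i.
  rewrite big_split_ord /=; congr addn.
    rewrite (eq_bigr (fun=> (sizeY p).-1)) ?sum_nat_const ?card_ord // => i _.
    by rewrite /d (unsplitK (inl i)).
  rewrite (eq_bigr (fun=> (sizeY q).-1)) ?sum_nat_const ?card_ord // => i _.
  by rewrite /d (unsplitK (inr i)).
rewrite /resultant coef_det_size_bound; last first.
  have size_band (u : {poly {poly K}}) (b : bool) l :
      (size (u`_l *+ b : {poly K}) <= (sizeY u).-1.+1)%N.
    case: b; last by rewrite size_poly0.
    exact: leq_trans (max_size_coefXY u l) (leqSpred _).
  by move=> i j; rewrite Sylvester_mxE /d; case: split => k; apply: size_band.
pose band (t : {poly K}) i j := t`_(j - i) *+ (i <= j)%N.
set A := \matrix_(i, j) _.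
have AE i j : A i j =
    match split i with
    | inl k => band (lead_coefX p) k j
    | inr k => band (lead_coefX q) k j
    end.
  rewrite mxE Sylvester_mxE /d /band.
  by case: split => k; rewrite coef_lead_coefX coefMn.
have trigA : is_trig_mx A.
  apply/is_trig_mxP => i j; rewrite AE /band; case: split_ordP => k -> /= lt_ij.
    by rewrite nth_default ?mul0rn // top_p subn_gt0.
  rewrite nth_default ?mul0rn // top_q (leq_trans (leqSpred _)) // ltn_subRL.
  by rewrite addnC.
rewrite det_trig //; apply/prodf_neq0 => i _; rewrite AE /band.
case: split_ordP => k -> /=.
  rewrite leqnn subnn mulr1n.
  have -> : 0%N = (size (lead_coefX p)).-1 by rewrite top_p.
  by rewrite -lead_coefE lead_coef_eq0 -size_poly_eq0 top_p.
rewrite leq_addl addnK mulr1n -top_q -lead_coefE lead_coef_eq0.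
by rewrite lead_coefX_eq0.
Qed.

(** * Factors with constant resultant *)

Lemma unit_size1 (K : fieldType) (u : {poly {poly K}}) :
  u != 0 -> (size u <= 1)%N -> (sizeY u <= 1)%N -> u \is a GRing.unit.
Proof.
move=> u0 sz1 Y1; have u_nz : u`_0 != 0.
  by apply: contraNneq u0 => u00; rewrite (size1_polyC sz1) u00.
have sz10 := leq_trans (max_size_coefXY u 0) Y1.
rewrite poly_unitE eqn_leq sz1 lt0n size_poly_eq0 u0 /=.
rewrite poly_unitE eqn_leq sz10 lt0n size_poly_eq0 u_nz /= unitfE.
by rewrite -(inj_eq (@polyC_inj _)) -size1_polyC.
Qed.

Lemma unit_of_small_resultant_r (K : fieldType) (p q : {poly {poly K}}) :
  size (lead_coefX p) = 1%N -> (1 < size p)%N -> (1 < sizeY p)%N ->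
  q != 0 -> size (lead_coefX q) = size q -> (size (resultant p q) <= 1)%N ->
  q \is a GRing.unit.
Proof.
move=> top_p sz_p Y_p q0 top_q sz_res.
have := leq_trans (size_resultant_lead_coefX top_p q0 top_q) sz_res.
rewrite ltnS leqn0 addn_eq0 !muln_eq0.
rewrite -!subn1 !subn_eq0 !(leqNgt (size p), leqNgt (sizeY p)) sz_p Y_p /= orbF.
by case/andP=> sz_q Y_q; apply: unit_size1.
Qed.

(** The degree bound only shows that p has degree 0 in X.  Then p equals its
    leading coefficient in X, which is constant. *)
Lemma unit_of_small_resultant_l (K : fieldType) (p q : {poly {poly K}}) :
  size (lead_coefX p) = 1%N -> (1 < size q)%N -> size (lead_coefX q) = size q ->
  (size (resultant p q) <= 1)%N -> p \is a GRing.unit.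
Proof.
move=> top_p sz_q top_q sz_res.
have q0 : q != 0 by rewrite -size_poly_gt0 ltnW.
have := leq_trans (size_resultant_lead_coefX top_p q0 top_q) sz_res.
rewrite ltnS leqn0 addn_eq0 => /andP[+ _].
rewrite muln_eq0 -!subn1 !subn_eq0 leqNgt sz_q /= => Y_p.
apply: unit_size1 => //; first by rewrite -lead_coefX_eq0 -size_poly_eq0 top_p.
apply/leq_sizeP => i lt0i.
(* Since deg_X p = 0, the entry p`_i is its own coefficient of X^0. *)
rewrite [p`__]size1_polyC ?(leq_trans (max_size_coefXY p i)) //.
have := coef_lead_coefX p i.
rewrite (_ : (sizeY p).-1 = 0%N); last by case: (sizeY p) Y_p => [|[]].
by move<-; rewrite nth_default // top_p.
Qed.

Lemma irreducible_poly_factor (K : fieldType) (r A B : {poly K}) (c : K) :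
  c != 0 -> irreducible_poly r -> A * B = c *: r ->
  (size A <= 1)%N \/ (size B <= 1)%N.
Proof.
move=> c0 [sz_r irr] AB.
have [->|szA] := eqVneq (size A) 1%N; first by left.
right; have r0 : r != 0 by rewrite -size_poly_gt0 ltnW.
have AB0 : A * B != 0 by rewrite AB scaler_eq0 negb_or c0.
have /eqp_size eq_sz : A %= r.
  by apply: irr => //; rewrite -(dvdpZr _ _ c0) -AB dvdp_mulr.
have := AB0; rewrite mulf_eq0 negb_or => /andP[A0 B0].
have := congr1 (fun u : {poly K} => size u) AB.
rewrite /= size_mul // size_scale // -eq_sz.
rewrite (polySpred A0) (polySpred B0) addSn addnS /= => -[] /eqP.
by rewrite -[X in _ == X]addn0 eqn_add2l => /eqP->.
Qed.

(** * The irreducibility criterion *)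

(* For p : {poly K}, [size p] is 1 + deg p, and 0 for p = 0, so comparing sizes
   is comparing degrees with deg 0 = -oo. *)
Theorem theorem7p11 (K : fieldType) (n m : nat) (a b : nat -> {poly K})
  (f g : {poly {poly K}})
  (n_ge1 : (1 <= n)%N) (n_lt_m : (n < m)%N)
  (f_def : f = \sum_(0 <= i < n.+1) a i *: 'X^i)
  (g_def : g = \sum_(0 <= i < m.+1) b i *: 'X^i)
  (ab_neq0 : a 0%N * a n * b 0%N * b m != 0)
  (f_no_factor : forall (c : {poly K}) (h : {poly {poly K}}),
     f = c%:P * h -> (size c <= 1)%N)
  (gcd_b : (size (\big[@gcdp K/0%R]_(n.+1 <= i < m.+1) b i) <= 1)%N)
  (res_irr : irreducible_poly (resultant f g))
  (deg_a0 : (\max_(1 <= i < n.+1) size (a i) < size (a 0%N))%N)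
  (deg_bm : (\max_(0 <= i < m) size (b i) <= size (b m))%N)
  (deg_ab : forall i : nat, (i <= n)%N -> (size (a i) <= size (b i))%N)
  (alpha beta : K) (alpha_beta : (alpha != 0) || (beta != 0)) :
  irreducible_elt (alpha%:P *: f + beta%:P *: g).
Proof.
move: ab_neq0; rewrite !mulf_eq0 !negb_or => /andP[/andP[/andP[a0 an] b0] bm].
have fE i : f`_i = if (i < n.+1)%N then a i else 0.
  by rewrite f_def big_mkord -poly_def coef_poly.
have gE i : g`_i = if (i < m.+1)%N then b i else 0.
  by rewrite g_def big_mkord -poly_def coef_poly.
have size_f : size f = n.+1 by rewrite f_def big_mkord -poly_def size_poly_eq.
have size_g : size g = m.+1 by rewrite g_def big_mkord -poly_def size_poly_eq.
have f0 : f != 0 by rewrite -size_poly_eq0 size_f.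
have g0 : g != 0 by rewrite -size_poly_eq0 size_g.
have lead_g : lead_coef g = b m by rewrite lead_coefE size_g gE ltnSn.
have lt_a i : (0 < i)%N -> (i <= n)%N -> (size (a i) < size (a 0))%N.
  move=> i_gt0 le_in; apply: leq_ltn_trans deg_a0.
  by apply: leq_bigmax_seq; rewrite // mem_index_iota i_gt0.
have le_b i : (size (g`_i)%R <= size (b m))%N.
  rewrite gE; case: ltnP => [|_]; last by rewrite size_poly0.
  rewrite ltnS leq_eqVlt => /predU1P[->//|lt_im]; apply: leq_trans deg_bm.
  by apply: leq_bigmax_seq; rewrite // mem_index_iota.
have le_f i : (size (f`_i)%R <= size (b m))%N.
  rewrite fE; case: ltnP => [lt_in|_]; last by rewrite size_poly0.
  apply: leq_trans (deg_ab _ lt_in) _.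
  by have := le_b i; rewrite gE (leq_trans lt_in (leqW n_lt_m)).
have top_f : size (lead_coefX f) = 1%N.
  apply: size_lead_coefX_const_dominant => [|i i_gt0]; rewrite !fE //=.
  case: (ltnP i n.+1) => [lt_in|_]; first exact: lt_a.
  by rewrite size_poly0 size_poly_gt0.
have top_g : size (lead_coefX g) = size g.
  by apply: size_lead_coefX_lead_dominant => // i; rewrite lead_g.
have Y_f : (1 < sizeY f)%N.
  apply: leq_trans (max_size_coefXY f 0); rewrite fE /=.
  by apply: leq_trans (lt_a _ n_ge1 (leqnn n)); rewrite ltnS size_poly_gt0.
have not_unit (u : {poly {poly K}}) : (1 < size u)%N -> u \isn't a GRing.unit.
  by rewrite poly_unitE; case: (size u) => [|[]].
have [beta0|beta0] := eqVneq beta 0.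
  (* The polynomial is alpha f, and its factors are tested against g. *)
  move: alpha_beta; rewrite beta0 eqxx orbF scale0r addr0 => alpha0.
  have alphaP0 : alpha%:P != 0 by rewrite polyC_eq0.
  set h := _ *: f; have size_h : size h = n.+1 by rewrite size_scale.
  have h0 : h != 0 by rewrite -size_poly_eq0 size_h.
  have [s res_gf] := resultantC f g.
  have res_h : resultant g h = (alpha ^+ m * (-1) ^+ s) *: resultant f g.
    have := @resultant_lin _ g f 0 alpha%:P g0 f0.
    rewrite mul0r add0r size_scale // size_g => -> //.
    by rewrite res_gf -scalerA -!mul_polyC !rmorphXn rmorphN1.
  have top_h : size (lead_coefX h) = 1%N.
    rewrite /h -mul_polyC lead_coefXM size_mul ?lead_coefX_eq0 ?polyC_eq0 //.
    rewrite top_f addn1 /=.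
    by rewrite /lead_coefX swapXY_polyC map_polyC lead_coefC size_polyC alpha0.
  have factor_unit u v : h = u * v ->
      (size (resultant g u) <= 1)%N -> u \is a GRing.unit.
    move=> h_uv; have [t ->] := resultantC u g; rewrite size_Msign => sz_res.
    apply: unit_of_small_resultant_l top_g sz_res.
      by apply: (@size_lead_coefX_factor1 _ u v); rewrite -h_uv.
    by rewrite size_g ltnS (leq_ltn_trans _ n_lt_m).
  split=> // [|u v h_uv]; first by rewrite not_unit ?size_h.
  have := h0; rewrite h_uv mulf_eq0 negb_or => /andP[u0 v0].
  have := res_h; rewrite h_uv resultantM // => res_uv.
  have c0 : alpha ^+ m * (-1) ^+ s != 0.
    by rewrite mulf_neq0 ?expf_neq0 ?oppr_eq0 ?oner_eq0.
  have [sz|sz] := irreducible_poly_factor c0 res_irr res_uv.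
    by left; apply: factor_unit h_uv sz.
  by right; apply: factor_unit sz; rewrite h_uv mulrC.
(* From here on beta is nonzero, and the factors are tested against f. *)
have betaP0 : beta%:P != 0 by rewrite polyC_eq0.
have size_lt : (size (alpha%:P *: f) < size (beta%:P *: g))%N.
  rewrite (size_scale g) // size_g; apply: leq_ltn_trans (size_scale_leq _ _) _.
  by rewrite size_f.
set h := _ + _.
have size_h : size h = size g by rewrite /h addrC size_polyDl // size_scale.
have h0 : h != 0 by rewrite -size_poly_eq0 size_h size_g.
have lead_h : lead_coef h = beta%:P * b m.
  by rewrite /h lead_coefDr // lead_coefZ lead_g.
have top_h : size (lead_coefX h) = size h.
  apply: size_lead_coefX_lead_dominant => // i.
  rewrite lead_h mul_polyC size_scale // coefD !coefZ !mul_polyC.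
  apply: leq_trans (size_polyD _ _) _; rewrite geq_max.
  by rewrite !(leq_trans (size_scale_leq _ _)).
have res_h : resultant f h = (beta ^+ n) *: resultant f g.
  have := @resultant_lin _ f g alpha%:P%:P beta%:P f0 g0.
  by rewrite mul_polyC -/h => -> //; rewrite size_f -mul_polyC rmorphXn.
have factor_unit u v : h = u * v ->
    (size (resultant f u) <= 1)%N -> u \is a GRing.unit.
  move=> h_uv; have := h0; rewrite h_uv => uv0.
  apply: unit_of_small_resultant_r => //; first by rewrite size_f.
    by apply: contraNneq uv0 => ->; rewrite mul0r.
  by apply: (@size_lead_coefX_factor _ u v) => //; rewrite -h_uv.
split=> // [|u v h_uv].
  by rewrite not_unit // size_h size_g ltnS (leq_trans _ n_lt_m).
have := h0; rewrite h_uv mulf_eq0 negb_or => /andP[u0 v0].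
have := res_h; rewrite h_uv resultantM // => res_uv.
have c0 : beta ^+ n != 0 by rewrite expf_neq0.
have [sz|sz] := irreducible_poly_factor c0 res_irr res_uv.
  by left; apply: factor_unit h_uv sz.
by right; apply: factor_unit sz; rewrite h_uv mulrC.
Qed.
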